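(* Let $C$ be a command of a stacks machine with stacks $S_1,\dots,S_{N-1}$, well typed in iSAPP (that is, $\vdash C:\mathbf A$ is derivable for some matrix $\mathbf A$), and let $\sigma_0,\sigma_n$ be states. If $\pi$ is a derivation of $\langle C,\sigma_0\rangle\to_c^{\alpha}\sigma_n$, then there is a polynomial $p$ such that the size $|\pi|$ is bounded by $p\bigl(\sum_{i}|\sigma_0(S_i)|\bigr)$. Here $|w|$ denotes the size (length) of the stack content $w$.
   Context: **Stacks machines.** A stacks machine has a finite alphabet $\Sigma$ containing $\mathsf{true},\mathsf{false}$; finitely many operators $\mathtt{op}:\Sigma^r\to\Sigma$, including a 0-ary operator $\mathtt{rand}$ (those with values in $\{\mathsf{true},\mathsf{false}\}$ are called predicates and written $\mathtt{op?}$); finitely many registers $\mathbf r$ (each holding a letter); finitely many stacks $S_1,\dots,S_{N-1}$ (each holding a finite word over $\Sigma$, written $\langle c_1\ldots c_q\rangle$ with $c_1$ on top; $\langle\rangle$ is the empty stack); and a set of defined functions. Syntax: Booleans $b ::= \mathsf{true}\mid\mathsf{false}\mid \mathtt{op?}(e_1,\dots,e_r)\mid \mathtt{rand}()\mid \mathtt{isempty?}(S)$. Expressions $e ::= c\mid \mathbf r\mid \mathtt{op}(e_1,\dots,e_r)\mid \mathtt{top}(S)$. Commands $C ::= \mathbf{skip}\mid \mathbf r:=e\mid S_i:=S_j\mid S_i:=\langle c_1\ldots c_q\rangle\mid S_i:=\mathbf{call}(f,S_{k_1},\dots,S_{k_m})\mid \mathbf{pop}(S)\mid \mathbf{push}(e,S)\mid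 C;C\mid \mathbf{If}\ b\ \mathbf{Then}\ C\ \mathbf{Else}\ C\mid \mathbf{loop}\ S_k\,\{C\}$, where in $\mathbf{loop}\ S_k\{C\}$ the stack $S_k$ may not appear in $C$. Function definitions: $\mathbf{def}\ f\ \mathbf{in}\ (S_1,\dots,S_m)\{C\}\ \mathbf{out}(S_j)$. **Evaluation.** A state $\sigma$ assigns a word to each stack and a letter to each register. Expressions evaluate without probability label: constants to themselves, $\mathbf r$ to $\sigma(\mathbf r)$, $\mathtt{top}(S)$ to $c_1$ if $\sigma(S)=\langle c_1\ldots c_q\rangle$, operators according to their implementation. Booleans evaluate with a probability label: $\mathtt{rand}()$ evaluates to $\mathsf{true}$ and to $\mathsf{false}$ with label $1/2$ each; $\mathtt{isempty?}(S)$ evaluates with label $1$, to $\mathsf{true}$ if $\sigma(S)=\langle\rangle$ and to $\mathsf{false}$ otherwise; predicates evaluate according to their implementation. **Semantics** $\langle C,\sigma\rangle\to_c^{\alpha}\sigma'$. With label $1$: $\mathbf{skip}$ leaves $\sigma$ unchanged; $\mathbf r:=e$, $S_i:=S_j$, $S_i:=\langle c_1\ldots c_q\rangle$ perform the assignment; if $\sigma(S)=\langle c_1,c_2,\dots,c_q\rangle$, $\mathbf{pop}(S)$ sets $S$ to $\langle c_2,\dots,c_q\rangle$; if $\sigma(S)=\langle c_1,\dots,c_q\rangle$, $\mathbf{push}(e,S)$ sets $S$ to $\langle e,c_1,\dots,c_q\rangle$. If $\langle C_1,\sigma\rangle\to_c^{\alpha}\sigma'$ and $\langle C_2,\sigma'\rangle\to_c^{\beta}\sigma''$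 then $\langle C_1;C_2,\sigma\rangle\to_c^{\alpha\beta}\sigma''$. If $b$ evaluates in $\sigma$ to $\mathsf{true}$ (resp. $\mathsf{false}$) with label $\alpha$ and $\langle C_1,\sigma\rangle\to_c^{\beta}\sigma'$ (resp. $\langle C_2,\sigma\rangle\to_c^{\beta}\sigma'$), then $\langle\mathbf{If}\ b\ \mathbf{Then}\ C_1\ \mathbf{Else}\ C_2,\sigma\rangle\to_c^{\alpha\beta}\sigma'$. If $\sigma(S_k)$ has length $q$ and $\langle C,\sigma_{t-1}\rangle\to_c^{\alpha_t}\sigma_t$ for $t=1,\dots,q$ with $\sigma_0=\sigma$, then $\langle\mathbf{loop}\ S_k\{C\},\sigma\rangle\to_c^{\prod_t\alpha_t}\sigma_q$ (for $q=0$: $\sigma$ with label $1$). Call: if $\mathbf{def}\ f\ \mathbf{in}\ (S_1,\dots,S_m)\{C\}\ \mathbf{out}(S_j)$ is a defined function and $\langle C,\tau\rangle\to_c^{\alpha}\sigma'$, where $\tau$ is $\sigma$ with $S_1,\dots,S_m$ replaced by the actual arguments $S_{k_1},\dots,S_{k_m}$, then $\langle S_i:=\mathbf{call}(f,S_{k_1},\dots,S_{k_m}),\sigma\rangle\to_c^{\alpha}\sigma'$. The size $|\pi|$ of a derivation $\pi$ built with these rules measures the number of execution steps. **Algebra.** $\{0,L,A,M\}$ is ordered by $0<L<A<M$. Union $\cup$ is the maximum. Sum: $0$ is neutral, $L+L=A$, otherwise $x+y=\max(x,y)$. Product: $0$ is absorbing, $L$ is neutral, and $x\times y=\max(x,y)$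 for $x,y\in\{A,M\}$. Matrices are $N\times N$ (the last index $N$ is for constants), with the usual sum and product built from these operations, and entrywise union and order; $\mathbf I$ has $L$ on the diagonal and $0$ elsewhere; $\mathbf V^v_i$ is the column vector with $v$ in row $i$ and $0$ elsewhere; $\mathbf A\xleftarrow{i}V$ is $\mathbf A$ with its $i$-th column replaced by $V$. Union closure: $\mathbf A^{\cup}=\bigcup_{i\ge0}\mathbf A^i$. Merge down $\mathbf A^{\downarrow k}$ ($k<N$): if $V$ is the $j$-th column of $\mathbf A$, the $j$-th column of $\mathbf A^{\downarrow k}$ is $V^{\downarrow k,j}$, defined as follows. For $j=N$: $(V^{\downarrow k,N})_i=V_i$ for all $i$. For $j<N$, row $k$: $(V^{\downarrow k,j})_k$ is $M$ if there is $p<N$, $p\ne k$, with $V_p\ne0$; otherwise it is $0$ if $V_N=0$, $L$ if $V_N=L$, $A$ if $V_N\ge A$ (and $V_k$ in any remaining case). For $j<N$, the other rows $i$: $(V^{\downarrow k,j})_i$ is $0$ if $i=N$; $M$ if $i\ne j$, $V_i\ne0$ and $V_j\ne0$; and $V_i$ otherwise. **Typing rules.** $\mathbf{skip}$, $\mathbf{pop}(S)$, $\mathbf r:=e$ have type $\mathbf I$. $S_i:=\langle c_1\ldots c_q\rangle$ has type $\mathbf I\xleftarrow{i}\mathbf V^A_N$ if $q>1$, $\mathbf I\xleftarrow{i}\mathbf V^L_N$ if $q=1$, $\mathbf I\xleftarrow{i}\mathbf V^0_N$ if $q=0$. $S_i:=S_j$ has type $\mathbf I\xleftarrow{i}\mathbf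 V^L_j$. $\mathbf{push}(e,S_i)$ has type $\mathbf I\xleftarrow{i}(\mathbf V^L_N+\mathbf V^L_i)$. If $C_1:\mathbf A$ and $C_2:\mathbf B$ then $C_1;C_2:\mathbf A\times\mathbf B$ and $\mathbf{If}\ b\ \mathbf{Then}\ C_1\ \mathbf{Else}\ C_2:\mathbf A\cup\mathbf B$. If $C:\mathbf A$ and $(\mathbf A^{\cup})_{i,i}<A$ for all $i$, then $\mathbf{loop}\ S_k\{C\}:(\mathbf A^{\cup})^{\downarrow k}$. If $C:\mathbf A$ and $\mathbf A\le\mathbf B$ then $C:\mathbf B$. If $C:\mathbf A$, then $\mathbf{def}\ f\ \mathbf{in}\ (S_1,\dots,S_m)\{C\}\ \mathbf{out}(S_j)$ has type $\mathbf A$, and then $S_i:=\mathbf{call}(f,S_{k_1},\dots,S_{k_m})$ has type $\mathbf I\xleftarrow{i}U$, where $U$ is the $j$-th column $V$ of $\mathbf A$ with its rows re-ordered by $1\to k_1,\dots,m\to k_m$ (rows not mentioned stay in place), rows landing on the same position being summed: $U_p=\sum_{h\to p}V_h$.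
   Formalization: In the merge down, row k of column j<N is V_k (not 0) if V_N and the other stack rows are 0; a call assigns to S_i only the body's final S_j and keeps the caller's other stacks, not the body's whole final state; with either literal clause some typed loops take exponential time. *)

(* Defs.v *)
From HB Require Import structures.
From mathcomp Require Import all_boot all_order all_algebra.
From mathcomp Require Import boolp.

Set Implicit Arguments.
Unset Strict Implicit.
Unset Printing Implicit Defensive.

Import Order.TTheory GRing.Theory.

Local Open Scope ring_scope.

Inductive grade := G0 | GL | GA | GM.

Definition grade_rank (x : grade) : nat :=
  match x with G0 => 0 | GL => 1 | GA => 2 | GM => 3 end.

Definition grade_unrank (i : nat) : grade :=
  match i with 0 => G0 | 1 => GL | 2 => GA | _ => GM end.

Lemma grade_rankK : cancel grade_rank grade_unrank.
Proof. by case. Qed.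

HB.instance Definition _ := Countable.copy grade (can_type grade_rankK).

Lemma grade_enumP : Finite.axiom [:: G0; GL; GA; GM].
Proof. by case. Qed.

HB.instance Definition _ := isFinite.Build grade grade_enumP.

Fact grade_display : Order.disp_t. Proof. exact: (Order.Disp tt tt). Qed.

Definition grade_le (x y : grade) := (grade_rank x <= grade_rank y)%N.
Definition grade_lt (x y : grade) := (grade_rank x < grade_rank y)%N.
Definition grade_min (x y : grade) := if grade_lt x y then x else y.
Definition grade_max (x y : grade) := if grade_lt x y then y else x.

Lemma grade_lt_def x y : grade_lt x y = (y != x) && grade_le x y.
Proof. by case: x; case: y. Qed.

Lemma grade_le_anti : antisymmetric grade_le.
Proof. by case; case. Qed.

Lemma grade_le_trans : transitive grade_le.
Proof. by move=> y x z; apply: leq_trans. Qed.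

Lemma grade_le_total : total grade_le.
Proof. by move=> x y; apply: leq_total. Qed.

HB.instance Definition _ :=
  Order.isOrder.Build grade_display grade grade_lt_def
    (fun _ _ => erefl : grade_min _ _ = _) (fun _ _ => erefl : grade_max _ _ = _)
    grade_le_anti grade_le_trans grade_le_total.

Definition grade_add (x y : grade) : grade :=
  match x, y with
  | G0, _ => y
  | _, G0 => x
  | GL, GL => GA
  | _, _ => Order.max x y
  end.

Definition grade_mul (x y : grade) : grade :=
  match x, y with
  | G0, _ | _, G0 => G0
  | GL, _ => y
  | _, GL => x
  | _, _ => Order.max x y
  end.

Lemma grade_addA : associative grade_add. Proof. by do 3?case. Qed.
Lemma grade_addC : commutative grade_add. Proof. by do 3?case. Qed.
Lemma grade_add0 : left_id G0 grade_add. Proof. by case. Qed.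
Lemma grade_mulA : associative grade_mul. Proof. by do 3?case. Qed.
Lemma grade_mulC : commutative grade_mul. Proof. by do 3?case. Qed.
Lemma grade_mul1 : left_id GL grade_mul. Proof. by case. Qed.
Lemma grade_mulDl : left_distributive grade_mul grade_add.
Proof. by do 3?case. Qed.
Lemma grade_mul0 : left_zero G0 grade_mul. Proof. by case. Qed.
Lemma grade_1neq0 : GL != G0.
Proof. by apply/eqP. Qed.

HB.instance Definition _ :=
  GRing.isNmodule.Build grade grade_addA grade_addC grade_add0.
HB.instance Definition _ :=
  GRing.Nmodule_isComNzSemiRing.Build grade
    grade_mulA grade_mulC grade_mul1 grade_mulDl grade_mul0 grade_1neq0.

(* With n = N - 1 stacks, matrices are indexed by 'I_n.+1: the stack S_(i+1)
   is the index [sidx i], the constants are the index [ord_max].  The unit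
   matrix I of the type system is the 1 of the semiring 'M[grade]_n.+1. *)
Definition sidx n (i : 'I_n) : 'I_n.+1 := widen_ord (leqnSn n) i.

Definition mx_le n (A B : 'M[grade]_n) : Prop := forall i j, (A i j <= B i j)%O.

Definition mx_union n (A B : 'M[grade]_n) : 'M[grade]_n :=
  \matrix_(i, j) Order.max (A i j) (B i j).

(* Each entry is the maximum of the set of values taken by that entry in the
   powers of A; this set is a nonempty part of the finite chain [grade]. *)
Definition union_closure n (A : 'M[grade]_n.+1) : 'M[grade]_n.+1 :=
  \matrix_(i, j) \big[Order.max/G0]_(x : grade | `[< exists m : nat, (A ^+ m) i j = x >]) x.

Definition colvec n (v : grade) (i : 'I_n) : 'cV[grade]_n :=
  \col_r (if r == i then v else 0).

Definition set_col n (A : 'M[grade]_n) (i : 'I_n) (V : 'cV[grade]_n) :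
    'M[grade]_n :=
  \matrix_(r, c) (if c == i then V r 0 else A r c).

(* In row k, when V_p = 0 for every p < N other than k, the value is L if
   V_N = L and A if V_N >= A; if V_N = 0 it is V_k, hence 0 unless V_k is
   itself nonzero.  The last case occurs for the column j = k of the closure
   of the body of a loop over S_k, whose diagonal entry is nonzero.  Replacing
   that entry by 0 would type [loop S_k {skip}] as if it emptied S_k, and a
   stack copied through S_k could then grow inside a loop without being
   detected. *)
Definition merge_col n (k : 'I_n) (j : 'I_n.+1) (V : 'cV[grade]_n.+1) :
    'cV[grade]_n.+1 :=
  \col_i
    if j == ord_max then V i 0
    else if i == sidx k then
      if [exists p : 'I_n, (p != k) && (V (sidx p) 0 != G0)] then GM
      else if V ord_max 0 == GL then GL
      else if (GA <= V ord_max 0)%O then GA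
      else V i 0
    else if i == ord_max then G0
    else if [&& i != j, V i 0 != G0 & V j 0 != G0] then GM
    else V i 0.

Definition merge_down n (k : 'I_n) (A : 'M[grade]_n.+1) : 'M[grade]_n.+1 :=
  \matrix_(i, j) merge_col k j (col j A) i 0.

(* [operator] lists the operators with a deterministic implementation; the
   probabilistic 0-ary operator rand, which is not a function, is the Boolean
   constructor [Brand].  [fname] lists the defined functions. *)
Record signature := Signature {
  letter : finType;
  ltrue : letter;
  lfalse : letter;
  ltrue_neq_lfalse : ltrue != lfalse;
  operator : finType;
  op_arity : operator -> nat;
  op_fun : forall o : operator, {ffun 'I_(op_arity o) -> letter} -> letter;
  register : finType;
  nstack : nat;
  fname : Type;
  fun_arity : fname -> nat;
  fun_arity_le : forall f, (fun_arity f <= nstack)%N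
}.

Notation stack G := 'I_(nstack G).

Definition is_predicate (G : signature) (o : operator G) : bool :=
  [forall x : {ffun 'I_(op_arity o) -> letter G},
     (op_fun x == ltrue G) || (op_fun x == lfalse G)].

Inductive expr (G : signature) :=
| Const of letter G
| Reg of register G
| Op (o : operator G) of 'I_(op_arity o) -> expr G
| Top of stack G.

Arguments Op {G} o args.

Inductive bexpr (G : signature) :=
| Btrue
| Bfalse
| Bop (o : operator G) of is_predicate o & 'I_(op_arity o) -> expr G
| Brand
| Bisempty of stack G.

Arguments Btrue {G}.
Arguments Bfalse {G}.
Arguments Bop {G} o pred_o args.
Arguments Brand {G}.

Inductive command (G : signature) :=
| Skip
| SetReg of register G & expr G
| Copy of stack G & stack G
| SetStack of stack G & seq (letter G)
| Call (i : stack G) (f : fname G) of 'I_(fun_arity f) -> stack G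
| Pop of stack G
| Push of expr G & stack G
| Seq of command G & command G
| If of bexpr G & command G & command G
| Loop of stack G & command G.

Arguments Skip {G}.
Arguments Call {G} i f args.

Fixpoint expr_occ (G : signature) (k : stack G) (e : expr G) : bool :=
  match e with
  | Const _ | Reg _ => false
  | Op o args => [exists i, expr_occ k (args i)]
  | Top i => i == k
  end.

Definition bexpr_occ (G : signature) (k : stack G) (b : bexpr G) : bool :=
  match b with
  | Btrue | Bfalse | Brand => false
  | Bop o _ args => [exists i, expr_occ k (args i)]
  | Bisempty i => i == k
  end.

Fixpoint command_occ (G : signature) (k : stack G) (C : command G) : bool :=
  match C with
  | Skip => false
  | SetReg _ e => expr_occ k e
  | Copy i j => (i == k) || (j == k)
  | SetStack i _ => i == k
  | Call i f args => (i == k) || [exists h, args h == k]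
  | Pop i => i == k
  | Push e i => expr_occ k e || (i == k)
  | Seq C1 C2 => command_occ k C1 || command_occ k C2
  | If b C1 C2 => [|| bexpr_occ k b, command_occ k C1 | command_occ k C2]
  | Loop i C1 => (i == k) || command_occ k C1
  end.

(* The side condition of the grammar: S_k does not appear in the body of a
   loop over S_k. *)
Fixpoint well_formed (G : signature) (C : command G) : bool :=
  match C with
  | Seq C1 C2 | If _ C1 C2 => well_formed C1 && well_formed C2
  | Loop k C1 => ~~ command_occ k C1 && well_formed C1
  | _ => true
  end.

(* The formal parameters of f are the first [fun_arity f] stacks. *)
Record machine := Machine {
  sig :> signature;
  fun_body : fname sig -> command sig;
  fun_out : fname sig -> stack sig;
  fun_body_wf : forall f, well_formed (fun_body f)
}.

Record state (G : signature) := State {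
  stk : {ffun stack G -> seq (letter G)};
  regs : {ffun register G -> letter G}
}.

Definition set_stk (G : signature) (s : state G) (i : stack G)
    (w : seq (letter G)) : state G :=
  State [ffun j => if j == i then w else stk s j] (regs s).

Definition set_reg (G : signature) (s : state G) (r : register G)
    (c : letter G) : state G :=
  State (stk s) [ffun r' => if r' == r then c else regs s r'].

Definition call_state (G : signature) (f : fname G)
    (args : 'I_(fun_arity f) -> stack G) (s : state G) : state G :=
  State [ffun j : stack G =>
           if insub (val j) is Some h then stk s (args h) else stk s j]
        (regs s).

(* Only the output stack of the function is transmitted, to S_i; the stacks of
   the caller other than S_i are kept, as the type of a call prescribes: were
   they taken from the final state s' of the body, a body doubling S_2 and
   returning S_1 could be iterated while the type of the call left S_2
   unchanged.  The registers, which types ignore, are those of s'. *)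
Definition return_state (G : signature) (i out : stack G) (s s' : state G) :
    state G :=
  State (stk (set_stk s i (stk s' out))) (regs s').

Inductive eval_expr (G : signature) (s : state G) :
    expr G -> letter G -> Type :=
| EConst c : eval_expr s (Const c) c
| EReg r : eval_expr s (Reg r) (regs s r)
| EOp (o : operator G) (args : 'I_(op_arity o) -> expr G)
      (v : {ffun 'I_(op_arity o) -> letter G}) :
    (forall i, eval_expr s (args i) (v i)) -> eval_expr s (Op o args) (op_fun v)
| ETop i c w : stk s i = c :: w -> eval_expr s (Top i) c.

Inductive eval_bexpr (G : signature) (s : state G) :
    bexpr G -> rat -> letter G -> Type :=
| BEtrue : eval_bexpr s Btrue 1 (ltrue G)
| BEfalse : eval_bexpr s Bfalse 1 (lfalse G)
| BEop (o : operator G) (pred_o : is_predicate o)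
       (args : 'I_(op_arity o) -> expr G)
       (v : {ffun 'I_(op_arity o) -> letter G}) :
    (forall i, eval_expr s (args i) (v i)) ->
    eval_bexpr s (Bop o pred_o args) 1 (op_fun v)
| BErand_true : eval_bexpr s Brand (1 / 2%:R) (ltrue G)
| BErand_false : eval_bexpr s Brand (1 / 2%:R) (lfalse G)
| BEisempty_true i : stk s i = [::] -> eval_bexpr s (Bisempty i) 1 (ltrue G)
| BEisempty_false i : stk s i <> [::] -> eval_bexpr s (Bisempty i) 1 (lfalse G).

(* An inhabitant of [exec C s a s'] is a derivation of <C, s> ->_c^a s', where
   a is the probability label.  In [XLoop] only st 0, ..., st q and
   a 0, ..., a (q - 1) matter, with q the length of S_k in s. *)
Inductive exec (M : machine) :
    command M -> state M -> rat -> state M -> Type :=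
| XSkip s : exec Skip s 1 s
| XSetReg s r e c : eval_expr s e c -> exec (SetReg r e) s 1 (set_reg s r c)
| XCopy s i j : exec (Copy i j) s 1 (set_stk s i (stk s j))
| XSetStack s i w : exec (SetStack i w) s 1 (set_stk s i w)
| XCall s s' i (f : fname M) (args : 'I_(fun_arity f) -> stack M) a :
    exec (fun_body f) (call_state args s) a s' ->
    exec (Call i f args) s a (return_state i (fun_out f) s s')
| XPop s i c w : stk s i = c :: w -> exec (Pop i) s 1 (set_stk s i w)
| XPush s i e c :
    eval_expr s e c -> exec (Push e i) s 1 (set_stk s i (c :: stk s i))
| XSeq s s' s'' C1 C2 a b :
    exec C1 s a s' -> exec C2 s' b s'' -> exec (Seq C1 C2) s (a * b) s''
| XIf_true s s' b C1 C2 a1 a2 :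
    eval_bexpr s b a1 (ltrue M) -> exec C1 s a2 s' ->
    exec (If b C1 C2) s (a1 * a2) s'
| XIf_false s s' b C1 C2 a1 a2 :
    eval_bexpr s b a1 (lfalse M) -> exec C2 s a2 s' ->
    exec (If b C1 C2) s (a1 * a2) s'
| XLoop s k C (st : nat -> state M) (a : nat -> rat) :
    st 0%N = s ->
    (forall t : 'I_(size (stk s k)), exec C (st t) (a t) (st t.+1)) ->
    exec (Loop k C) s (\prod_(t < size (stk s k)) a t) (st (size (stk s k))).

(* All rule instances are counted, including those evaluating expressions and
   Booleans. *)
Fixpoint eval_expr_size (G : signature) (s : state G) e c
    (d : eval_expr s e c) : nat :=
  match d with
  | EConst _ | EReg _ | ETop _ _ _ _ => 1
  | EOp o args v ds => (\sum_i eval_expr_size (ds i)).+1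
  end.

Definition eval_bexpr_size (G : signature) (s : state G) b a c
    (d : eval_bexpr s b a c) : nat :=
  match d with
  | BEop o _ args v ds => (\sum_i eval_expr_size (ds i)).+1
  | _ => 1
  end.

Fixpoint exec_size (M : machine) C (s : state M) a s' (d : exec C s a s') : nat :=
  match d with
  | XSetReg _ _ _ _ de | XPush _ _ _ _ de => (eval_expr_size de).+1
  | XCall _ _ _ _ _ _ d1 => (exec_size d1).+1
  | XSeq _ _ _ _ _ _ _ d1 d2 => (exec_size d1 + exec_size d2).+1
  | XIf_true _ _ _ _ _ _ _ db d1 => (eval_bexpr_size db + exec_size d1).+1
  | XIf_false _ _ _ _ _ _ _ db d2 => (eval_bexpr_size db + exec_size d2).+1
  | XLoop _ _ _ _ _ _ ds => (\sum_t exec_size (ds t)).+1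
  | _ => 1
  end.

(* The row to which the row h of the type of a function is moved. *)
Definition call_row (G : signature) (f : fname G)
    (args : 'I_(fun_arity f) -> stack G) (h : 'I_((nstack G).+1)) :
    'I_((nstack G).+1) :=
  if insub (val h) is Some h' then sidx (args h') else h.

Definition call_col (G : signature) (f : fname G)
    (args : 'I_(fun_arity f) -> stack G) (V : 'cV[grade]_((nstack G).+1)) :
    'cV[grade]_((nstack G).+1) :=
  \col_p \sum_(h | call_row args h == p) V h 0.

Definition const_grade (q : nat) : grade :=
  match q with 0 => G0 | 1 => GL | _ => GA end.

Reserved Notation "|- C \: A" (at level 70, C at level 69, A at level 69).

Inductive typed (M : machine) :
    command M -> 'M[grade]_((nstack M).+1) -> Prop :=
| TSkip : |- Skip \: 1
| TPop i : |- Pop i \: 1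
| TSetReg r e : |- SetReg r e \: 1
| TSetStack i w :
    |- SetStack i w \: set_col 1 (sidx i) (colvec (const_grade (size w)) ord_max)
| TCopy i j : |- Copy i j \: set_col 1 (sidx i) (colvec GL (sidx j))
| TPush e i :
    |- Push e i \: set_col 1 (sidx i) (colvec GL ord_max + colvec GL (sidx i))
| TSeq C1 C2 A B : |- C1 \: A -> |- C2 \: B -> |- Seq C1 C2 \: A * B
| TIf b C1 C2 A B :
    |- C1 \: A -> |- C2 \: B -> |- If b C1 C2 \: mx_union A B
| TLoop k C A :
    |- C \: A -> (forall i, (union_closure A i i < GA)%O) ->
    |- Loop k C \: merge_down k (union_closure A)
| TSub C A B : |- C \: A -> mx_le A B -> |- C \: B
| TCall i (f : fname M) (args : 'I_(fun_arity f) -> stack M) A :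
    |- fun_body f \: A ->
    |- Call i f args \:
         set_col 1 (sidx i) (call_col args (col (sidx (fun_out f)) A))
where "|- C \: A" := (typed C A).

(* Main.v *)
(* A type A bounds the final size of S_j by the sum of the initial sizes of the
   S_i with A_ij = L plus a polynomial in those with A_ij >= A: this invariant
   is stable under all typing rules, and the size of a derivation is polynomial
   along with it.  Neither the difference between A and M nor the row of the
   constants matters.  The crux is the loop.  A diagonal of the closure below A
   forces every entry >= A to leave its strongly connected component in the
   dependency graph, and every stack to have at most one predecessor inside its
   component, with entry L.  Hence one round increases the maximum of the sizes
   over a component by at most a polynomial in the stacks of the components
   above, and q rounds by at most q times a polynomial in q and the initial
   sizes of these stacks. *)
Require Import Defs.
From mathcomp Require Import all_boot all_order all_algebra.
From mathcomp Require Import boolp zify.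

Set Implicit Arguments.
Unset Strict Implicit.
Unset Printing Implicit Defensive.

Import Order.TTheory GRing.Theory.

(** * Polynomially bounded functions *)

(** The base is at least 2 even at [x = 0], so constants, sums and products are absorbed by raising
    the exponent, and the single number [K] describes a polynomial bound. *)
Definition polybounded (f : nat -> nat) : Prop :=
  exists K, forall x, f x <= (2 + x) ^ K.

Lemma polybounded_le f g :
  (forall x, f x <= g x) -> polybounded g -> polybounded f.
Proof. by move=> fg [K gK]; exists K => x; apply: leq_trans (gK x). Qed.

Lemma polybounded_const c : polybounded (fun=> c).
Proof.
exists c => x; apply: (@leq_trans (2 ^ c)); first exact/ltnW/ltn_expl.
by case: c => // c; rewrite leq_exp2r // leq_addr.
Qed.

Lemma polybounded_id : polybounded id.
Proof. by exists 1 => x; rewrite expn1 leq_addl. Qed.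

Lemma polybounded_mul f g :
  polybounded f -> polybounded g -> polybounded (fun x => f x * g x).
Proof.
by move=> [K fK] [L gL]; exists (K + L) => x; rewrite expnD leq_mul.
Qed.

Lemma polybounded_add f g :
  polybounded f -> polybounded g -> polybounded (fun x => f x + g x).
Proof.
move=> [K fK] [L gL]; apply: (@polybounded_le _ (fun x => 2 * (2 + x) ^ (K + L))).
  move=> x; rewrite mul2n -addnn leq_add //.
    by apply: leq_trans (fK x) _; rewrite leq_pexp2l // leq_addr.
  by apply: leq_trans (gL x) _; rewrite leq_pexp2l // leq_addl.
apply: polybounded_mul; first exact: polybounded_const.
by exists (K + L) => x.
Qed.

Lemma polybounded_exp f K :
  polybounded f -> polybounded (fun x => f x ^ K).
Proof.
move=> [L fL]; exists (L * K) => x; rewrite expnM.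
by case: K => // K; rewrite leq_exp2r.
Qed.

#[local] Hint Resolve polybounded_const polybounded_id : polyb.
#[local] Hint Resolve polybounded_add polybounded_mul polybounded_exp : polyb.

(** * Grade arithmetic and the growth bounds it describes *)

Lemma grade_leDl (x y : grade) : (x <= (x + y)%R)%O.
Proof. by case: x; case: y. Qed.

Lemma grade_ge_sum (I : finType) (F : I -> grade) i :
  (F i <= (\sum_j F j)%R)%O.
Proof. by rewrite (bigD1 i) //= grade_leDl. Qed.

(** Already [L + L = A]: this is how the algebra records that a size is used twice. *)
Lemma grade_sum_ge2 (I : finType) (F : I -> grade) i j :
  i != j -> F i != G0 -> F j != G0 -> (GA <= (\sum_h F h)%R)%O.
Proof.
move=> ij; rewrite (bigD1 i) //= (bigD1 j) 1?eq_sym //=.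
by move: (F i) (F j) (\sum_(h | _) _)%R => [] [] [].
Qed.

Section Growth.

Variable m : nat.
Implicit Types (V W : 'I_m -> grade) (v : 'I_m -> nat).

(* A size vector v, transformed by a command with column V for some stack,
   yields a stack of size at most [growth V K v]: coefficient 1 for grade L,
   a polynomial for the grades A and M (whose difference plays no role). *)
Definition growth V K v :=
  \sum_(i | V i == GL) v i + (2 + \sum_(i | (GA <= V i)%O) v i) ^ K.

Definition growth_bounded V (F : ('I_m -> nat) -> nat) : Prop :=
  exists K, forall v, F v <= growth V K v.

Lemma growth_leK V K L v : K <= L -> growth V K v <= growth V L v.
Proof. by move=> KL; rewrite leq_add2l leq_pexp2l. Qed.

Lemma growth_mono V K v w : (forall i, v i <= w i) -> growth V K v <= growth V K w.
Proof.
move=> vw; apply: leq_add; first exact: leq_sum.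
by case: K => // K; rewrite leq_exp2r // leq_add2l leq_sum.
Qed.

Lemma growth_le_total V K v :
  growth V K v <= \sum_i v i + (2 + \sum_i v i) ^ K.
Proof.
have le_tot (P : pred 'I_m) : \sum_(i | P i) v i <= \sum_i v i.
  by rewrite [leqRHS](bigID P) leq_addr.
by apply: leq_add => //; case: K => // K; rewrite leq_exp2r // leq_add2l.
Qed.

Lemma growth_bounded_le F G V :
  (forall v, F v <= G v) -> growth_bounded V G -> growth_bounded V F.
Proof. by move=> FG [K GK]; exists K => v; apply: leq_trans (GK v). Qed.

Lemma growth_bounded_const V c : growth_bounded V (fun=> c).
Proof.
have [K cK] := polybounded_const c; exists K => v.
by apply: leq_trans (cK _) _; apply: leq_addl.
Qed.

Lemma growth_var_le V i v : V i != G0 -> v i <= growth V 1 v.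
Proof.
move=> Vi; rewrite /growth expn1.
have [ViL|ViL] := eqVneq (V i) GL.
  by rewrite (bigD1 i) ?ViL //=; lia.
have ViA : (GA <= V i)%O by move: (V i) Vi ViL => [].
by rewrite [X in 2 + X](bigD1 i) //=; lia.
Qed.

Lemma growth_bounded_var V i : V i != G0 -> growth_bounded V (fun v => v i).
Proof. by move=> Vi; exists 1 => v; apply: growth_var_le. Qed.

(** A variable linear in both columns has grade A in the sum, so the linear parts lose at most
    [2 * z] to the polynomial part, where [z] sums the variables of grade at least A. *)
Lemma growth_bounded_add V W F G :
  growth_bounded V F -> growth_bounded W G ->
  growth_bounded (fun i => V i + W i)%R (fun v => F v + G v).
Proof.
move=> [K FK] [L GL'].
have [E HE] : polybounded (fun z => 2 * z + ((2 + z) ^ K + (2 + z) ^ L)).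
  by auto with polyb.
exists E => v.
apply: leq_trans (leq_add (FK v) (GL' v)) _; rewrite /growth.
set z := \sum_(i | (GA <= (V i + W i)%R)%O) v i.
have big_le (U : 'I_m -> grade) e :
    (forall i, (GA <= U i)%O -> (GA <= (V i + W i)%R)%O) ->
    (2 + \sum_(i | (GA <= U i)%O) v i) ^ e <= (2 + z) ^ e.
  move=> UVW; case: e => // e; rewrite leq_exp2r // leq_add2l /z.
  rewrite [leqLHS]big_mkcond [leqRHS]big_mkcond leq_sum // => i _.
  by case: ifP => // /UVW ->.
have hK := big_le V K; have hL := big_le W L.
have lin_le : \sum_(i | V i == GL) v i + \sum_(i | W i == GL) v i <=
    \sum_(i | (V i + W i)%R == GL) v i + 2 * z.
  rewrite /z [X in X + _ <= _]big_mkcond [X in _ + X <= _]big_mkcond.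
  rewrite [X in _ <= X + _]big_mkcond [X in _ <= _ + _ * X]big_mkcond.
  rewrite big_distrr -!big_split leq_sum // => i _ /=.
  by move: (V i) (W i) => [] [] /=; rewrite ?eqxx /= ?muln0 ?addn0; lia.
have {}hK : (2 + \sum_(i | (GA <= V i)%O) v i) ^ K <= (2 + z) ^ K.
  by apply: hK => i; move: (V i) (W i) => [] [].
have {}hL : (2 + \sum_(i | (GA <= W i)%O) v i) ^ L <= (2 + z) ^ L.
  by apply: hL => i; move: (V i) (W i) => [] [].
have arith a b c d p q p' q' e : a + b <= c + d -> p <= p' -> q <= q' ->
    d + (p' + q') <= e -> a + p + (b + q) <= c + e by lia.
exact: arith lin_le hK hL (HE z).
Qed.

Lemma growth_bounded_sub V W F :
  (forall i, (V i <= W i)%O) -> growth_bounded V F -> growth_bounded W F.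
Proof.
move=> VW [K FK].
have [E HE] : polybounded (fun z => z + (2 + z) ^ K) by auto with polyb.
exists E => v; apply: leq_trans (FK v) _; rewrite /growth.
set z := \sum_(i | (GA <= W i)%O) v i.
have lin_le : \sum_(i | V i == GL) v i <= \sum_(i | W i == GL) v i + z.
  rewrite /z [X in X <= _]big_mkcond [X in _ <= X + _]big_mkcond.
  rewrite [X in _ <= _ + X]big_mkcond -big_split leq_sum // => i _ /=.
  by move: (V i) (W i) (VW i) => [] [] //= _; lia.
have pow_le : (2 + \sum_(i | (GA <= V i)%O) v i) ^ K <= (2 + z) ^ K.
  case: (K) => // e; rewrite leq_exp2r // leq_add2l /z.
  rewrite [leqLHS]big_mkcond [leqRHS]big_mkcond leq_sum // => i _.
  by case: ifP => // Vi; rewrite (le_trans Vi (VW i)).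
apply: leq_trans (leq_add lin_le pow_le) _.
by rewrite -addnA leq_add2l HE.
Qed.

(** Without an entry L, the bound is a pure power of 2 plus the variables of grade at least A, and
    such bounds are stable under powers. *)
Lemma growth_bounded_exp V F K :
  (forall i, (V i == G0) || (GA <= V i)%O) ->
  growth_bounded V F -> growth_bounded V (fun v => (2 + F v) ^ K).
Proof.
move=> V0A [L FL].
have [E HE] : polybounded (fun z => (2 + (2 + z) ^ L) ^ K) by auto with polyb.
exists E => v; rewrite /growth.
set z := \sum_(i | (GA <= V i)%O) v i.
apply: leq_trans (leq_addl _ _); apply: leq_trans (HE z).
case: K {HE} => // e; rewrite leq_exp2r // leq_add2l.
apply: leq_trans (FL v) _; rewrite /growth big_pred0 // => i.
by apply: contraTF (V0A i) => /eqP ->.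
Qed.

Lemma growth_bounded_sum (I : finType) (V : I -> 'I_m -> grade) F :
  (forall h, growth_bounded (V h) (F h)) ->
  growth_bounded (fun i => \sum_h V h i)%R (fun v => \sum_h F h v).
Proof.
move=> VF; elim: (index_enum I) => [|h s IHs].
  apply: (@growth_bounded_le _ (fun=> 0)); last exact: growth_bounded_const.
  by move=> v; rewrite big_nil.
apply: (@growth_bounded_le _ (fun v => F h v + \sum_(h <- s) F h v)).
  by move=> v; rewrite big_cons.
apply: growth_bounded_sub (growth_bounded_add (VF h) IHs).
by move=> i; rewrite big_cons.
Qed.

End Growth.

(** The grade of [B h] splits the product. L is neutral, so an [h] used linearly passes on its
    column unchanged ([V1]). An [h] used polynomially turns every nonzero entry into a grade at
    least A ([V2]), which is what [growth_bounded_exp] requires. *)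
Lemma growth_bounded_comp m p (A : 'I_m -> 'I_p -> grade) (B : 'I_p -> grade) K
    (F : 'I_p -> ('I_m -> nat) -> nat) :
  (forall h, growth_bounded (A^~ h) (F h)) ->
  growth_bounded (fun i => \sum_h A i h * B h)%R
    (fun v => growth B K (fun h => F h v)).
Proof.
move=> AF.
pose V1 h i := if B h == GL then A i h else 0%R.
pose V2 h i := if (GA <= B h)%O then (A i h * B h)%R else 0%R.
have bd1 : growth_bounded (fun i => \sum_h V1 h i)%R
    (fun v => \sum_(h | B h == GL) F h v).
  apply: (@growth_bounded_le _ _ (fun v => \sum_h if B h == GL then F h v else 0)).
    by move=> v; rewrite -big_mkcond.
  apply: growth_bounded_sum => h; rewrite /V1.
  by case: (B h == GL); [apply: AF | apply: growth_bounded_const].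
have bd2 : growth_bounded (fun i => \sum_h V2 h i)%R
    (fun v => \sum_(h | (GA <= B h)%O) F h v).
  apply: (@growth_bounded_le _ _
    (fun v => \sum_h if (GA <= B h)%O then F h v else 0)).
    by move=> v; rewrite -big_mkcond.
  apply: growth_bounded_sum => h; rewrite /V2.
  case Bh: (GA <= B h)%O; last exact: growth_bounded_const.
  apply: growth_bounded_sub (AF h) => i.
  by move: (A i h) (B h) Bh => [] [].
have V2_0A i : ((\sum_h V2 h i)%R == G0) || (GA <= (\sum_h V2 h i)%R)%O.
  elim/big_ind: _ => [//|x y|h _]; first by move: x y => [] [].
  by rewrite /V2; move: (A i h) (B h) => [] [].
apply: growth_bounded_sub (growth_bounded_add bd1 (growth_bounded_exp K V2_0A bd2)).
move=> i; rewrite -big_split /= (eq_bigr (fun h => A i h * B h)%R) // => h _.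
by rewrite /V1 /V2; move: (A i h) (B h) => [] [].
Qed.

(** * Walks in the dependency graph of a matrix *)

Section Dependency.

Variables (n : nat) (A : 'M[grade]_n.+1).

Lemma powermx_le_closure m i j : ((A ^+ m)%R i j <= union_closure A i j)%O.
Proof.
rewrite /union_closure mxE.
by apply: (le_bigmax_cond G0 id); apply/asboolP; exists m.
Qed.

(** Reachability in the graph whose edges are the nonzero entries of [A]: grades cannot cancel, so
    an entry of [A ^+ m] is nonzero exactly when a walk of length [m] exists. *)
Definition depends : rel 'I_n.+1 := fun i j => union_closure A i j != G0.

Lemma dependsP i j : reflect (exists m, (A ^+ m)%R i j != G0) (depends i j).
Proof.
apply: (iffP idP) => [|[m Am0]]; last first.
  move: (powermx_le_closure m i j) Am0; rewrite /depends.
  by move: ((A ^+ m)%R i j) (union_closure A i j) => [] [].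
rewrite /depends /union_closure mxE.
elim/big_ind: _ => [//|x y IHx IHy|x /asboolP[m <-]]; last by exists m.
by rewrite /Order.max; case: ifP.
Qed.

Lemma powermx_leD l m i h j :
  ((A ^+ l)%R i h * (A ^+ m)%R h j <= (A ^+ (l + m))%R i j)%O%R.
Proof.
rewrite exprD mxE.
exact: (grade_ge_sum (fun h => (A ^+ l)%R i h * (A ^+ m)%R h j)%R).
Qed.

Lemma depends_refl : reflexive depends.
Proof. by move=> i; apply/dependsP; exists 0; rewrite expr0 mxE eqxx. Qed.

Lemma depends_trans : transitive depends.
Proof.
move=> h i j /dependsP[l Al] /dependsP[m Am]; apply/dependsP; exists (l + m).
have := powermx_leD l m i h j.
by move: (_ i j) (_ i h) (_ h j) Al Am => [] [] [].
Qed.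

Lemma depends1 i j : A i j != G0 -> depends i j.
Proof. by move=> Aij; apply/dependsP; exists 1; rewrite expr1. Qed.

Hypothesis diag_lt : forall i, (union_closure A i i < GA)%O.

Lemma powermx_diag_lt m i : ((A ^+ m)%R i i < GA)%O.
Proof. exact: le_lt_trans (powermx_le_closure m i i) (diag_lt i). Qed.

Lemma closure_diag i : union_closure A i i = GL.
Proof.
by have := diag_lt i; have := depends_refl i; rewrite /depends; case: (_ i i).
Qed.

(** A walk back from [j] to [i] would close a cycle through this entry, and the product along it
    would put a grade at least A on the diagonal of a power. *)
Lemma not_depends_ge i j : (GA <= A i j)%O -> ~~ depends j i.
Proof.
move=> Aij; apply/negP => /dependsP[m Am].
have := powermx_leD m 1 j i j; have := powermx_diag_lt (m + 1) j.
by rewrite expr1; move: (_ j j) (_ j i) (A i j) Am Aij => [] [] [].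
Qed.

(* Two distinct such predecessors h, h' of j would close two loops through j;
   running them in both orders yields two walks of the same length, whose
   weights L add up to A on the diagonal. *)
Lemma uniq_cyclic_pred h h' j :
  A h j != G0 -> A h' j != G0 -> depends j h -> depends j h' -> h = h'.
Proof.
move=> Ah Ah' /dependsP[m Am] /dependsP[m' Am']; apply/eqP.
case: eqVneq => // hh'; exfalso.
(* A walk from [j] to [g], the edge back to [j], then a walk from [j] to [g']. *)
have path_neq0 l g g' : A g j != G0 -> (A ^+ l)%R j g != G0 ->
    forall l', (A ^+ l')%R j g' != G0 -> (A ^+ (l + 1 + l'))%R j g' != G0.
  move=> Ag Al l' Al'.
  have := powermx_leD l 1 j g j; have := powermx_leD (l + 1) l' j j g'.
  rewrite expr1.
  by move: (_ j g') (_ j j) (_ j g') (_ j g) (A g j) Al Ag Al' => [] [] [] [] [].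
have Sh := path_neq0 _ _ h Ah' Am' _ Am.
have Sh' := path_neq0 _ _ h' Ah Am _ Am'.
have eqS : m + 1 + m' = m' + 1 + m by lia.
rewrite eqS in Sh'.
have := powermx_diag_lt (m' + 1 + m).+1 j.
rewrite exprSr mxE ltNge => /negP; apply.
apply: (grade_sum_ge2 hh').
  by move: (_ j h) (A h j) Sh Ah => [] [].
by move: (_ j h') (A h' j) Sh' Ah' => [] [].
Qed.

End Dependency.

(** * Sums of sizes and the iteration of a bounded step *)

Lemma leq_sum_uniq (I : finType) (P : pred I) (F : I -> nat) c :
  (forall i j, P i -> P j -> i = j) -> (forall i, P i -> F i <= c) ->
  \sum_(i | P i) F i <= c.
Proof.
move=> P_uniq Fc; case: (pickP P) => [i Pi|P0]; last by rewrite big_pred0.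
rewrite (big_pred1 i) ?Fc // => j; apply/idP/eqP => [Pj|->] //.
exact: P_uniq.
Qed.

Lemma leq_sum_const n (P : pred 'I_n) (F : 'I_n -> nat) c :
  (forall i, P i -> F i <= c) -> \sum_(i | P i) F i <= n * c.
Proof.
move=> Fc; apply: (@leq_trans (\sum_(i | P i) c)); first exact: leq_sum.
rewrite sum_nat_const leq_mul2r.
by apply/orP; right; rewrite -[leqRHS](card_ord n) max_card.
Qed.

Lemma leq_sum_sub (I : finType) (P Q : pred I) (F : I -> nat) :
  (forall i, P i -> Q i) -> \sum_(i | P i) F i <= \sum_(i | Q i) F i.
Proof.
move=> PQ; rewrite [leqLHS]big_mkcond [leqRHS]big_mkcond leq_sum // => i _.
by case: ifP => // /PQ ->.
Qed.

Section Iteration.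

Variables (n : nat) (A : 'M[grade]_n.+1) (K0 : nat).
Hypothesis diag_lt : forall i, (union_closure A i i < GA)%O.

Let sim i j := depends A i j && depends A j i.
Let above i j := depends A i j && ~~ depends A j i.
(** The number of ancestors grows strictly along [above], so it serves as the measure for an
    induction over components. *)
Let rank j := #|[pred i | depends A i j]|.

Lemma rank_above h j : above h j -> rank h < rank j.
Proof.
move=> /andP[hj njh]; apply: proper_card; apply/properP; split.
  by apply/subsetP => i; rewrite !inE => /depends_trans; apply.
by exists j; rewrite !inE // depends_refl.
Qed.

(** All that the iteration argument retains of [q] rounds of a loop, with [v t] the sizes after [t]
    rounds. *)
Definition steps_bounded q (v : nat -> 'I_n.+1 -> nat) :=
  forall t, t < q -> forall j, v t.+1 j <= growth (A^~ j) K0 (v t).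

(* By induction on the strongly connected components of the dependency graph,
   from the sources on.  Within a component every stack has at most one
   predecessor, which it uses with coefficient 1, so each step increases the
   maximum over the component by at most a polynomial in the stacks above. *)
Lemma iterate_bound_rank r : exists K, forall q v, steps_bounded q v ->
  forall j, rank j < r -> forall t, t <= q ->
  v t j <= \sum_(i | sim i j) v 0 i
           + (2 + (q + \sum_(i | above i j) v 0 i)) ^ K.
Proof.
elim: r => [|r [K IH]]; first by exists 0.
(* With [X] as below, [u X] bounds a stack above [j], [f X] a sum of such stacks, and [g X] the
   increase in one round. Since [q] is a summand of [X], all rounds together add at most
   [X * g X]. *)
pose u x := x + (2 + x) ^ K.
pose f x := n.+1 * u x.
pose g x := f x + (2 + f x) ^ K0.
have [K' HK'] : polybounded (fun x => x * g x).
  by rewrite /g /f /u; auto 20 with polyb.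
exists K' => q v stepv j rank_j; set X := q + _.
have leqX h : above h j -> forall t, t <= q -> v t h <= u X.
  move=> hj t tq; have /andP[dhj ndjh] := hj.
  have rank_h : rank h < r by apply: leq_trans (rank_above hj) _.
  apply: leq_trans (IH q v stepv h rank_h t tq) _.
  (* Every ancestor of [h] lies above [j], so the induction hypothesis for [h] only mentions sizes
     counted in [X]. *)
  have sub_above i : depends A i h -> above i j.
    move=> ih; rewrite /above (depends_trans ih dhj) /=.
    by apply: contra ndjh => /depends_trans; apply.
  have le_above (P : pred 'I_n.+1) : (forall i, P i -> depends A i h) ->
      \sum_(i | P i) v 0 i <= \sum_(i | above i j) v 0 i.
    by move=> Ph; apply: leq_sum_sub => i /Ph /sub_above.
  apply: leq_add.
    by apply: leq_trans (leq_addl _ _); apply: le_above => i /andP[].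
  case: (K) => // e; rewrite leq_exp2r // leq_add2l leq_add2l.
  by apply: le_above => i /andP[].
(* The bound is the same for every [i] of the component, so passing to the single cyclic predecessor
   preserves it. *)
have bound_sim t : t <= q -> forall i, sim i j ->
    v t i <= \sum_(h | sim h j) v 0 h + t * g X.
  elim: t => [|t IHt] tq i ij.
    by rewrite mul0n addn0 (bigD1 i) //= leq_addr.
  have /andP[dij dji] := ij.
  apply: leq_trans (stepv t tq i) _.
  have -> : \sum_(h | sim h j) v 0 h + t.+1 * g X =
      \sum_(h | sim h j) v 0 h + t * g X + f X + (2 + f X) ^ K0.
    by rewrite mulSn (addnC (g X)) addnA -[RHS]addnA.
  apply: leq_add.
    (* Linear predecessors of [i] reachable from [j] lie in the component, so there is at most one;
       the others lie above [j]. *)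
    rewrite (bigID (depends A j)) /=; apply: leq_add.
      apply: leq_sum_uniq => [h h' /andP[/eqP Ah jh] /andP[/eqP Ah' jh']|h].
        apply: (@uniq_cyclic_pred _ _ diag_lt h h' i).
        - by rewrite Ah.
        - by rewrite Ah'.
        - exact: depends_trans dij jh.
        - exact: depends_trans dij jh'.
      move=> /andP[/eqP Ah jh]; apply: IHt; first exact: ltnW.
      by rewrite /sim jh andbT (depends_trans _ dij) // depends1 // Ah.
    apply: leq_sum_const => h /andP[/eqP Ah njh].
    apply: leqX (ltnW tq).
    by rewrite /above njh andbT (depends_trans _ dij) // depends1 // Ah.
  have le_f : \sum_(h | (GA <= A h i)%O) v t h <= f X.
    apply: leq_sum_const => h Ah; apply: leqX (ltnW tq).
    have := not_depends_ge diag_lt Ah => nih.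
    rewrite /above (depends_trans _ dij) /=; last first.
      by apply: depends1; case: (A h i) Ah.
    by apply: contra nih => /(depends_trans dij).
  by case: (K0) => // e; rewrite leq_exp2r // leq_add2l.
move=> t tq; apply: leq_trans (bound_sim t tq j _) _.
  by rewrite /sim depends_refl.
rewrite leq_add2l; apply: leq_trans (HK' X).
by rewrite leq_mul2r (leq_trans tq) ?orbT // leq_addr.
Qed.

(** This form matches [merge_down], which turns dependencies off the diagonal into M: only [j]
    itself stays linear, and the rest of its component joins the polynomial part. *)
Lemma iterate_bound : exists K, forall q v, steps_bounded q v ->
  forall j t, t <= q ->
  v t j <= v 0 j + (2 + (q + \sum_(i | (i != j) && depends A i j) v 0 i)) ^ K.
Proof.
(* A rank is at most [n.+1], the number of indices, so [n.+2] covers every [j]. *)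
have [K HK] := iterate_bound_rank n.+2.
have [K' HK'] : polybounded (fun x => x + (2 + x) ^ K) by auto with polyb.
exists K' => q v stepv j t tq; set Y := \sum_(i | _) _.
have rank_j : rank j < n.+2.
  by rewrite ltnS -[leqRHS](card_ord n.+1) max_card.
apply: leq_trans (HK q v stepv j rank_j t tq) _.
rewrite (bigD1 j) /=; last by rewrite /sim depends_refl.
rewrite -addnA leq_add2l; apply: leq_trans (HK' _); apply: leq_add.
  apply: leq_trans (leq_addl _ _).
  by apply: leq_sum_sub => i /andP[/andP[-> _] ->].
case: (K) => // e; rewrite leq_exp2r // leq_add2l leq_add2l.
apply: leq_sum_sub => i /andP[ij nji]; rewrite ij andbT.
by apply: contra nji => /eqP ->; apply: depends_refl.
Qed.

End Iteration.

(** * Stack sizes, evaluation costs and merged columns *)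

Lemma sidx_inj n : injective (@sidx n).
Proof. by move=> i i' /(congr1 val) /= /val_inj. Qed.

Lemma sidx_neq_max n (i : 'I_n) : sidx i != ord_max.
Proof. by rewrite -val_eqE /= ltn_eqF. Qed.

Lemma ord_sidxP n (j : 'I_n.+1) : j = ord_max \/ exists i, j = sidx i.
Proof.
case: (ltnP j n) => [lt_j|le_j].
  by right; exists (Ordinal lt_j); apply: val_inj.
left; apply/val_inj/eqP; by rewrite eqn_leq le_j -ltnS ltn_ord.
Qed.

Section Sizes.

Variable G : signature.
Implicit Types (s : state G) (i k : stack G).

(** The index of the constants gets size 0: constants are absorbed by the power in [growth]. *)
Definition sizes s (j : 'I_(nstack G).+1) : nat :=
  if insub (val j) is Some i then size (stk s i) else 0.

Lemma sizes_sidx s i : sizes s (sidx i) = size (stk s i).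
Proof.
rewrite /sizes insubT //= => lt_i; congr (size (stk s _)); exact: val_inj.
Qed.

Lemma sizes_max s : sizes s ord_max = 0.
Proof. by rewrite /sizes insubF //= ltnn. Qed.

Lemma sizes_call_state (f : fname G) (args : 'I_(fun_arity f) -> stack G) s j :
  sizes (call_state args s) j = sizes s (call_row args j).
Proof.
rewrite /call_row; case: insubP => [h _ hj|jf].
  rewrite sizes_sidx /sizes; case: insubP => [i _ ij|].
    rewrite ffunE; case: insubP => [h' _ hj'|]; last by rewrite ij -hj ltn_ord.
    by congr (size (stk s (args _))); apply: val_inj; rewrite hj' ij.
  by rewrite -hj (leq_trans (ltn_ord h)) ?fun_arity_le.
rewrite /sizes; case: insubP => [i _ ij|//].
by rewrite ffunE insubF // ij (negbTE jf).
Qed.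

Lemma sum_sizes s : \sum_j sizes s j = \sum_i size (stk s i).
Proof.
rewrite big_ord_recr /= sizes_max addn0.
by apply: eq_bigr => i _; rewrite -[RHS]sizes_sidx.
Qed.

Lemma stk_set_stk s i w k : stk (set_stk s i w) k = if k == i then w else stk s k.
Proof. by rewrite ffunE. Qed.

(** Evaluation derivations follow the syntax, so their size is a constant of the expression,
    independent of the state. *)
Fixpoint expr_size (e : expr G) : nat :=
  if e is Op o args then (\sum_i expr_size (args i)).+1 else 1.

Definition bexpr_size (b : bexpr G) : nat :=
  if b is Bop o _ args then (\sum_i expr_size (args i)).+1 else 1.

Lemma eval_expr_sizeE s e c (d : eval_expr s e c) : eval_expr_size d = expr_size e.
Proof.
elim: d => //= o args v ds IH; congr _.+1; exact: eq_bigr.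
Qed.

Lemma eval_bexpr_sizeE s b a c (d : eval_bexpr s b a c) :
  eval_bexpr_size d = bexpr_size b.
Proof.
case: d => //= o pred_o args v ds; congr _.+1.
by apply: eq_bigr => i _; apply: eval_expr_sizeE.
Qed.

End Sizes.

(** Three of the possible values are nonzero grades, and the remaining one is the old diagonal
    entry. *)
Lemma merge_down_refl n (k : 'I_n) (U : 'M[grade]_n.+1) :
  U (sidx k) (sidx k) != G0 -> merge_down k U (sidx k) (sidx k) != G0.
Proof.
move=> Ukk; rewrite 2!mxE (negbTE (sidx_neq_max k)) eqxx.
by do 3![case: ifP => // _]; rewrite mxE.
Qed.

Lemma merge_down_diag n (k j : 'I_n) (U : 'M[grade]_n.+1) :
  j != k -> merge_down k U (sidx j) (sidx j) = U (sidx j) (sidx j).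
Proof.
move=> jk; rewrite 2!mxE (negbTE (sidx_neq_max j)).
by rewrite (inj_eq (@sidx_inj _)) (negbTE jk) eqxx mxE.
Qed.

(** The nonzero diagonal entry of [j] triggers M both times: as the witness [p = j] in row [k], and
    as the condition on [V j] in the other rows. *)
Lemma merge_down_neq n (k i j : 'I_n) (U : 'M[grade]_n.+1) :
  j != k -> i != j -> U (sidx j) (sidx j) != G0 ->
  (i == k) || (U (sidx i) (sidx j) != G0) ->
  merge_down k U (sidx i) (sidx j) = GM.
Proof.
move=> jk ij Ujj; rewrite 2!mxE !(negbTE (sidx_neq_max _)).
rewrite !(inj_eq (@sidx_inj _)) ij; case: (i == k) => /= [_|Uij].
  by case: existsP => // -[]; exists j; rewrite jk mxE.
by rewrite !mxE Uij Ujj.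
Qed.

(** * Soundness of the typing rules *)

Section Soundness.

Variable M : machine.
Implicit Types (C : command M) (s : state M) (A B : 'M[grade]_((nstack M).+1)).

(** Inversion by matching on the command, which keeps the subderivations together with their
    contribution to the size [m]. *)
Definition exec_inv_spec C s s' (m : nat) : Prop :=
  match C with
  | Skip => m = 1 /\ s' = s
  | SetReg _ e => m = (expr_size e).+1 /\ stk s' = stk s
  | Copy i j => m = 1 /\ s' = set_stk s i (stk s j)
  | SetStack i w => m = 1 /\ s' = set_stk s i w
  | Call i f args => exists s1 a (d : exec (fun_body f) (call_state args s) a s1),
      m = (exec_size d).+1 /\ s' = return_state i (fun_out f) s s1
  | Pop i => m = 1 /\ s' = set_stk s i (behead (stk s i))
  | Push e i => m = (expr_size e).+1 /\
      exists c, s' = set_stk s i (c :: stk s i)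
  | Seq C1 C2 => exists s1 a1 a2 (d1 : exec C1 s a1 s1) (d2 : exec C2 s1 a2 s'),
      m = (exec_size d1 + exec_size d2).+1
  | If b C1 C2 =>
      (exists a (d : exec C1 s a s'), m = (bexpr_size b + exec_size d).+1) \/
      (exists a (d : exec C2 s a s'), m = (bexpr_size b + exec_size d).+1)
  | Loop k C1 => exists (st : nat -> state M) (a : nat -> rat)
      (ds : forall t : 'I_(size (stk s k)), exec C1 (st t) (a t) (st t.+1)),
      [/\ st 0 = s, m = (\sum_t exec_size (ds t)).+1 & s' = st (size (stk s k))]
  end.

Lemma exec_inv C s a s' (d : exec C s a s') : exec_inv_spec C s s' (exec_size d).
Proof.
case: d => //=.
- by move=> {}s r e c de; rewrite eval_expr_sizeE.
- by move=> {}s {}s' i f args {}a d; exists s', a, d.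
- by move=> {}s i c w ->.
- by move=> {}s i e c de; rewrite eval_expr_sizeE; split => //; exists c.
- by move=> {}s s1 s2 C1 C2 a1 a2 d1 d2; exists s1, a1, a2, d1, d2.
- by move=> {}s {}s' b C1 C2 a1 a2 db d1; left; exists a2, d1;
  rewrite eval_bexpr_sizeE.
- by move=> {}s {}s' b C1 C2 a1 a2 db d1; right; exists a2, d1;
  rewrite eval_bexpr_sizeE.
- by move=> {}s k C1 st {}a st0 ds; exists st, a, ds.
Qed.

(** For a call the body need not be inspected: [return_state] keeps every stack of the caller except
    the assigned one. *)
Lemma exec_not_occ k C s a s' :
  exec C s a s' -> ~~ command_occ k C -> stk s' k = stk s k.
Proof.
move=> d; elim: d => //=.
- by move=> {}s i j; rewrite negb_or stk_set_stk eq_sym => /andP[/negbTE ->].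
- by move=> {}s i w; rewrite stk_set_stk eq_sym => /negbTE ->.
- by move=> {}s {}s' i f args {}a d _; rewrite negb_or stk_set_stk eq_sym
    => /andP[/negbTE ->].
- by move=> {}s i c w _; rewrite stk_set_stk eq_sym => /negbTE ->.
- by move=> {}s i e c _; rewrite negb_or stk_set_stk eq_sym => /andP[_ /negbTE ->].
- move=> {}s s1 s2 C1 C2 a1 a2 d1 IH1 d2 IH2; rewrite negb_or => /andP[k1 k2].
  by rewrite IH2 ?IH1.
- by move=> {}s {}s' b C1 C2 a1 a2 _ d1 IH;
  rewrite !negb_or => /and3P[_ k1 _]; apply: IH.
- by move=> {}s {}s' b C1 C2 a1 a2 _ d1 IH;
  rewrite !negb_or => /and3P[_ _ k2]; apply: IH.
- move=> {}s i C1 st {}a st0 ds IH; rewrite negb_or => /andP[_ kC1].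
  have stk_st t : t <= size (stk s i) -> stk (st t) k = stk s k.
    elim: t => [|t IHt] tq; first by rewrite st0.
    by rewrite (IH (Ordinal tq) kC1) IHt // ltnW.
  exact: stk_st.
Qed.

(** The size of derivations alone would not compose: the second command of a sequence, or a later
    round of a loop, starts from the sizes left by what precedes it. *)
Definition sound C A : Prop :=
  exists K, forall s a s' (d : exec C s a s'),
    (forall j, sizes s' j <= growth (A^~ j) K (sizes s)) /\
    exec_size d <= (2 + \sum_j sizes s j) ^ K.

Lemma soundI C A (F : 'I_(nstack M).+1 -> ('I_(nstack M).+1 -> nat) -> nat) g :
  (forall j, growth_bounded (A^~ j) (F j)) -> polybounded g ->
  (forall s a s' (d : exec C s a s'),
     (forall j, sizes s' j <= F j (sizes s)) /\
     exec_size d <= g (\sum_j sizes s j)) ->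
  sound C A.
Proof.
move=> /fin_all_exists/=[K FK] [L gL] bound.
exists (L + \max_j K j) => s a s' d; have [le_F le_g] := bound s a s' d.
split=> [j|].
  apply: leq_trans (le_F j) _; apply: leq_trans (FK j _) _; apply: growth_leK.
  by apply: leq_trans (leq_addl _ _); apply: leq_bigmax.
apply: leq_trans le_g _; apply: leq_trans (gL _) _.
by rewrite leq_pexp2l // leq_addr.
Qed.

Lemma sound_growthI C A K g : polybounded g ->
  (forall s a s' (d : exec C s a s'),
     (forall j, sizes s' j <= growth (A^~ j) K (sizes s)) /\
     exec_size d <= g (\sum_j sizes s j)) ->
  sound C A.
Proof.
move=> g_pb; apply: (soundI (F := fun j => growth (A^~ j) K)) g_pb => j.
by exists K.
Qed.

Lemma sound_set_col C i (V : 'cV[grade]_((nstack M).+1)) F g :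
  growth_bounded (fun r => V r 0%R) F -> polybounded g ->
  (forall s a s' (d : exec C s a s'),
     [/\ forall k, k != i -> stk s' k = stk s k,
         size (stk s' i) <= F (sizes s) &
         exec_size d <= g (\sum_j sizes s j)]) ->
  sound C (set_col 1%R (sidx i) V).
Proof.
move=> VF g_pb bound.
apply: (@soundI _ _ (fun j v => if j == sidx i then F v
                                else if j == ord_max then 0 else v j) g) => //.
  move=> j; case: (eqVneq j (sidx i)) => [->|ji].
    by apply: growth_bounded_sub VF => r; rewrite mxE eqxx.
  case: eqP => _; first exact: growth_bounded_const.
  by apply: growth_bounded_var; rewrite !mxE (negbTE ji) eqxx.
move=> s a s' d; have [out_i in_i le_g] := bound s a s' d; split=> //.
move=> j; have [->|[k ->]] := ord_sidxP j; first by rewrite sizes_max.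
rewrite (inj_eq (@sidx_inj _)) (negbTE (sidx_neq_max k)) !sizes_sidx.
by case: eqP => [->|/eqP /out_i ->].
Qed.

Lemma sound_sub C A B : mx_le A B -> sound C A -> sound C B.
Proof.
move=> AB [K bound].
apply: (@soundI _ _ (fun j v => growth (A^~ j) K v) (fun x => (2 + x) ^ K)) => //.
- by move=> j; apply: (@growth_bounded_sub _ (A^~ j)) => //; exists K.
- by exists K.
Qed.

Lemma sound_one C g : polybounded g ->
  (forall s a s' (d : exec C s a s'),
     (forall k, size (stk s' k) <= size (stk s k)) /\
     exec_size d <= g (\sum_j sizes s j)) ->
  sound C 1%R.
Proof.
move=> g_pb bound; apply: (@soundI _ _ (fun j v => v j) g) => // [j|s a s' d].
  by apply: growth_bounded_var; rewrite mxE eqxx.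
have [le_s le_g] := bound s a s' d; split=> //.
by move=> j; have [->|[k ->]] := ord_sidxP j; rewrite ?sizes_max // !sizes_sidx.
Qed.

Lemma sound_seq C1 C2 A B :
  sound C1 A -> sound C2 B -> sound (Seq C1 C2) (A * B)%R.
Proof.
move=> [K1 b1] [K2 b2].
(* The derivation for [C2] is measured on the sizes left by [C1]: [(nstack M).+1] entries, each at
   most [x + (2 + x) ^ K1]. *)
apply: (@soundI _ _
  (fun j v => growth (B^~ j) K2 (fun h => growth (A^~ h) K1 v))
  (fun x => ((2 + x) ^ K1 + (2 + (nstack M).+1 * (x + (2 + x) ^ K1)) ^ K2).+1)).
- move=> j; apply: growth_bounded_sub (growth_bounded_comp (A := A) (B^~ j) K2 _).
    by move=> i; rewrite mxE.
  by move=> h; exists K1.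
- apply: (@polybounded_le _ (fun x => 1 + ((2 + x) ^ K1 +
    (2 + (nstack M).+1 * (x + (2 + x) ^ K1)) ^ K2))) => //.
  by auto 20 with polyb.
move=> s a s' d.
have [s1 [a1 [a2 [d1 [d2 ->]]]]] := exec_inv d.
have [le1 size1] := b1 _ _ _ d1; have [le2 size2] := b2 _ _ _ d2.
split=> [j|]; first by apply: leq_trans (le2 j) _; apply: growth_mono.
rewrite ltnS leq_add //; apply: leq_trans size2 _.
case: (K2) => // e; rewrite leq_exp2r // leq_add2l.
apply: leq_sum_const => j _; apply: leq_trans (le1 j) _.
exact: growth_le_total.
Qed.

Lemma sound_if b C1 C2 A B :
  sound C1 A -> sound C2 B -> sound (If b C1 C2) (mx_union A B).
Proof.
move=> [K1 b1] [K2 b2].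
have [K1' b1'] : sound C1 (mx_union A B).
  by apply: (@sound_sub _ A); [move=> i j; rewrite mxE le_max lexx | exists K1].
have [K2' b2'] : sound C2 (mx_union A B).
  apply: (@sound_sub _ B); last by exists K2.
  by move=> i j; rewrite mxE le_max lexx orbT.
apply: (@sound_growthI _ _ (K1' + K2')
  (fun x => (bexpr_size b + (2 + x) ^ (K1' + K2')).+1)).
  apply: (@polybounded_le _
    (fun x => 1 + (bexpr_size b + (2 + x) ^ (K1' + K2')))) => //.
  by auto with polyb.
have le1 : K1' <= K1' + K2' := leq_addr _ _.
have le2 : K2' <= K1' + K2' := leq_addl _ _.
move=> s a s' d; case: (exec_inv d) => [[a1 [d1 ->]]|[a1 [d1 ->]]].
  have [le_s le_size] := b1' _ _ _ d1; split=> [j|].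
    by apply: leq_trans (le_s j) _; apply: growth_leK.
  by rewrite ltnS leq_add2l (leq_trans le_size) // leq_pexp2l.
have [le_s le_size] := b2' _ _ _ d1; split=> [j|].
  by apply: leq_trans (le_s j) _; apply: growth_leK.
by rewrite ltnS leq_add2l (leq_trans le_size) // leq_pexp2l.
Qed.

Lemma sound_call i (f : fname M) (args : 'I_(fun_arity f) -> stack M) A :
  sound (fun_body f) A ->
  sound (Call i f args)
    (set_col 1%R (sidx i) (call_col args (col (sidx (fun_out f)) A))).
Proof.
move=> [K bound].
(* Argument passing is a command whose matrix has an L where row [h] moves to [p]; a call composes
   it with the body. *)
pose W h p := if call_row args h == p then GL else 0%R.
apply: (@sound_set_col _ _ _
  (fun v => growth (A^~ (sidx (fun_out f))) K (fun h => v (call_row args h)))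
  (fun x => 1 + (2 + (nstack M).+1 * x) ^ K)).
- apply: growth_bounded_sub (growth_bounded_comp
      (A := fun p h => W h p) (A^~ (sidx (fun_out f))) K _).
    move=> p; rewrite mxE [leRHS]big_mkcond le_eqVlt; apply/orP; left; apply/eqP.
    by apply: eq_bigr => h _; rewrite /W mxE; case: ifP => _;
      [rewrite mul1r | rewrite mul0r].
  by move=> h; apply: growth_bounded_var; rewrite /W eqxx.
- by auto 20 with polyb.
move=> s a s' d.
have [s1 [a1 [d1 [-> ->]]]] := exec_inv d.
have [le_s le_size] := bound _ _ _ d1; split.
- by move=> k ki; rewrite stk_set_stk (negbTE ki).
- rewrite stk_set_stk eqxx -sizes_sidx; apply: leq_trans (le_s _) _.
  by apply: growth_mono => h; rewrite sizes_call_state.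
rewrite ltnS; apply: leq_trans le_size _.
case: (K) => // e; rewrite leq_exp2r // leq_add2l.
(* One stack may be passed for several parameters, so each entry is bounded separately by the whole
   sum. *)
apply: leq_sum_const => j _; rewrite sizes_call_state.
by rewrite (bigD1 (call_row args j)) //= leq_addr.
Qed.

Lemma sound_loop k C A : ~~ command_occ k C ->
  (forall i, (union_closure A i i < GA)%O) ->
  sound C A -> sound (Loop k C) (merge_down k (union_closure A)).
Proof.
move=> kC diag_lt [K0 bound].
have [K iter_le] := iterate_bound K0 diag_lt.
pose N := (nstack M).+1.
(* The factor 2 pays for [q] and the other dependencies both being at most [z]; the successor keeps
   the exponent positive for column [k]. In the size bound, [x] stands for the number of rounds, and
   each round starts from entries at most [x + (2 + (x + x)) ^ K]. *)
apply: (@sound_growthI _ _ (2 * K).+1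
  (fun x => 1 + x * (2 + N * (x + (2 + (x + x)) ^ K)) ^ K0)).
  by auto 20 with polyb.
move=> s a s' d.
have [st [b [ds [st0 -> ->]]]] := exec_inv d.
set q := size (stk s k).
have steps : steps_bounded A K0 q (fun t => sizes (st t)).
  by move=> t tq j; have [le_s _] := bound _ _ _ (ds (Ordinal tq)).
have le_st := iter_le _ _ steps; rewrite st0 in le_st.
have qE : q = sizes s (sidx k) by rewrite sizes_sidx.
have le_total j : sizes s j <= \sum_j sizes s j by rewrite (bigD1 j) //= leq_addr.
split; last first.
  rewrite ltnS; apply: (@leq_trans (q * (2 + N *
      (\sum_j sizes s j + (2 + (\sum_j sizes s j + \sum_j sizes s j)) ^ K)) ^ K0)).
    apply: leq_sum_const => t _; have [_ le_size] := bound _ _ _ (ds t).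
    apply: leq_trans le_size _; case: (K0) => // e; rewrite leq_exp2r // leq_add2l.
    apply: leq_sum_const => j _; apply: leq_trans (le_st j t (ltnW (ltn_ord t))) _.
    apply: leq_add => //; case: (K) => // e'; rewrite leq_exp2r // leq_add2l.
    apply: leq_add; first by rewrite qE.
    by rewrite [leqRHS](bigID (fun i => (i != j) && depends A i j)) leq_addr.
  by rewrite leq_mul2r qE le_total orbT.
move=> j'; have [->|[j ->]] := ord_sidxP j'; first by rewrite sizes_max.
set V := merge_down k (union_closure A).
have closure_neq0 i : union_closure A i i != G0 by rewrite closure_diag.
have [->|jk] := eqVneq j k.
  have stk_st t : t <= q -> stk (st t) k = stk s k.
    elim: t => [|t IHt] tq; first by rewrite st0.
    by rewrite (exec_not_occ (ds (Ordinal tq)) kC) IHt // ltnW.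
  rewrite sizes_sidx stk_st // -sizes_sidx.
  apply: leq_trans (growth_var_le (V := V^~ (sidx k)) _ _) _.
    exact: merge_down_refl.
  exact: growth_leK.
apply: leq_trans (le_st (sidx j) q (leqnn q)) _; apply: leq_add.
  by rewrite [leqRHS](bigD1 (sidx j)) ?leq_addr // merge_down_diag // closure_diag.
set z := \sum_(i | (GA <= _)%O) _.
have le_z : \sum_(i | (i != sidx j) && depends A i (sidx j)) sizes s i <= z.
  rewrite /z [leqLHS]big_mkcond [leqRHS]big_mkcond leq_sum // => h _.
  have [->|[i ->]] := ord_sidxP h; first by rewrite sizes_max; case: ifP.
  case: ifP => // /andP[]; rewrite (inj_eq (@sidx_inj _)) => ij Uij.
  by rewrite merge_down_neq //; apply/orP; right.
(* The number of rounds is the size of [S_k], and the merge put M in row [k] of column [j], so [q]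
   is one of the summands of [z]. *)
have le_qz : q <= z.
  rewrite qE /z (bigD1 (sidx k)) ?leq_addr //= merge_down_neq ?eqxx //.
  by rewrite eq_sym.
apply: leq_trans (_ : _ <= ((2 + z) ^ 2) ^ K) _.
  case: (K) => // e; rewrite leq_exp2r // expnS expn1 mulnDl.
  by apply: leq_add; nia.
by rewrite -expnM leq_pexp2l.
Qed.

(** The induction is on the typing derivation, not on the command: the typing of a call contains
    that of the function body, so an induction hypothesis is available there. *)
Theorem typed_sound C A : well_formed C -> typed C A -> sound C A.
Proof.
move=> wfC tC; elim: tC wfC => {C A} /=.
- move=> _; apply: (@sound_one _ (fun=> 1)) => [|s a s' d].
    exact: polybounded_const.
  by have [-> ->] := exec_inv d.
- move=> i _; apply: (@sound_one _ (fun=> 1)) => [|s a s' d].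
    exact: polybounded_const.
  have [-> ->] := exec_inv d; split=> // k; rewrite stk_set_stk.
  by case: eqP => // ->; rewrite size_behead leq_pred.
- move=> r e _; apply: (@sound_one _ (fun=> (expr_size e).+1)) => [|s a s' d].
    exact: polybounded_const.
  by have [-> ->] := exec_inv d.
- move=> i w _; apply: (@sound_set_col _ _ _ (fun=> size w) (fun=> 1)).
  + exact: growth_bounded_const.
  + exact: polybounded_const.
  + move=> s a s' d; have [-> ->] := exec_inv d.
    by split=> // [l /negbTE li|]; rewrite stk_set_stk ?li ?eqxx.
- move=> i j _; apply: (@sound_set_col _ _ _ (fun v => v (sidx j)) (fun=> 1)).
  + by apply: growth_bounded_var; rewrite mxE eqxx.
  + exact: polybounded_const.
  + move=> s a s' d; have [-> ->] := exec_inv d.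
    by split=> // [l /negbTE li|]; rewrite stk_set_stk ?li ?eqxx ?sizes_sidx.
- move=> e i _; apply: (@sound_set_col _ _ _ (fun v => 1 + v (sidx i))
    (fun=> (expr_size e).+1)).
  + apply: growth_bounded_sub (growth_bounded_add
      (growth_bounded_const (fun r => colvec GL ord_max r 0%R) 1)
      (growth_bounded_var (V := fun r => colvec GL (sidx i) r 0%R) _)).
      by move=> r; rewrite !mxE.
    by rewrite mxE eqxx.
  + exact: polybounded_const.
  + move=> s a s' d; have [-> [c ->]] := exec_inv d.
    by split=> // [l /negbTE li|]; rewrite stk_set_stk ?li ?eqxx ?sizes_sidx.
- by move=> C1 C2 A B _ IH1 _ IH2 /andP[/IH1 s1 /IH2 s2]; apply: sound_seq.
- by move=> b C1 C2 A B _ IH1 _ IH2 /andP[/IH1 s1 /IH2 s2]; apply: sound_if.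
- by move=> k C A _ IH diag_lt /andP[kC /IH sC]; apply: sound_loop.
- by move=> C A B _ IH AB /IH; apply: sound_sub.
- by move=> i f args A _ IH _; apply: sound_call; apply: IH; apply: fun_body_wf.
Qed.

End Soundness.

Theorem theorem17 (M : machine) (C : command M) :
  well_formed C ->
  (exists A : 'M[grade]_((nstack M).+1), typed C A) ->
  exists p : {poly nat},
    forall (s0 sn : state M) (a : rat) (d : exec C s0 a sn),
      (exec_size d <= p.[\sum_(i < nstack M) size (stk s0 i)]%R)%N.
Proof.
move=> wfC [A /(typed_sound wfC)[K bound]].
exists (('X + 2%:P) ^+ K)%R => s0 sn a d.
have [_ le_size] := bound _ _ _ d.
rewrite sum_sizes in le_size; apply: leq_trans le_size _.
by rewrite horner_exp hornerD hornerX hornerC -natrXE /= addnC.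
Qed.
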